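(* Let $n$ be a positive integer. (i) If $n\geq 11$ and $n$ is odd, then the lattice $\mathrm{Quo}(n)$ is $(1+1+2)$-generated. (ii) If $n\geq 13$, then the lattice $\mathrm{Quo}(n)$ is $(1+1+2)$-generated.
   Context: A quasiorder (preorder) of a set $A$ is a reflexive and transitive relation $\rho\subseteq A^2$. The set $\mathrm{Quo}(A)$ of all quasiorders of $A$, ordered by set inclusion, is a lattice, called the quasiorder lattice of $A$: the meet is $\rho\wedge\tau=\rho\cap\tau$ and the join $\rho\vee\tau$ is the transitive closure of $\rho\cup\tau$. For $n$ a positive integer, $\mathrm{Quo}(n)$ denotes (up to isomorphism) $\mathrm{Quo}(A)$ for an $n$-element set $A$. A four-element subset $X$ of a poset $Y$ is a $(1+1+2)$-subset of $Y$ if exactly two elements of $X$ are comparable (that is, exactly one unordered pair of distinct elements of $X$ is comparable). A $(1+1+2)$-generating set of a lattice $L$ is a $(1+1+2)$-subset $X$ of $L$ that generates $L$ (the smallest sublattice of $L$, i.e. subset closed under binary $\wedge$ and $\vee$, containing $X$ is $L$ itself). A lattice is $(1+1+2)$-generated if it has a $(1+1+2)$-generating set. *)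

(* Defs.v *)
From HB Require Import structures.
From mathcomp Require Import all_boot all_order.

Set Implicit Arguments.
Unset Strict Implicit.
Unset Printing Implicit Defensive.

Import Order.Theory.
Local Open Scope order_scope.

Definition sublattice d (L : finLatticeType d) (S : {set L}) : Prop :=
  {in S &, forall x y, x `&` y \in S} /\ {in S &, forall x y, x `|` y \in S}.

(* The sublattice generated by X is the intersection of the sublattices
   containing X, so it is L itself iff L is the only such sublattice. *)
Definition generates d (L : finLatticeType d) (X : {set L}) : Prop :=
  forall S : {set L}, sublattice S -> X \subset S -> S = [set: L].

(* Unordered pairs of distinct elements are represented as 2-element sets. *)
Definition comparable_pairs d (Y : finPOrderType d) (X : {set Y}) :
    {set {set Y}} :=
  [set [set x; y] | x in X, y in X & (x != y) && (x >=< y)].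

Definition is_112_subset d (Y : finPOrderType d) (X : {set Y}) : Prop :=
  #|X| = 4 /\ #|comparable_pairs X| = 1.

Definition is_112_generating_set d (L : finLatticeType d) (X : {set L}) :
    Prop :=
  is_112_subset X /\ generates X.

Definition is_112_generated d (L : finLatticeType d) : Prop :=
  exists X : {set L}, is_112_generating_set X.

Definition graph_rel (A : finType) (r : {set A * A}) : rel A :=
  fun x y => (x, y) \in r.

Definition quasiorder (A : finType) (r : {set A * A}) : bool :=
  [forall x, graph_rel r x x] &&
  [forall x, forall y, forall z,
     graph_rel r x y ==> graph_rel r y z ==> graph_rel r x z].

Lemma quasiorderP (A : finType) (r : {set A * A}) :
  reflect (reflexive (graph_rel r) /\ transitive (graph_rel r)) (quasiorder r).
Proof.
apply: (iffP andP) => [[/forallP rr /forallP rt]|[rr rt]]; split=> //.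
- move=> y x z xy yz.
  by have /forallP/(_ y)/forallP/(_ z) := rt x; rewrite xy yz.
- exact/forallP.
apply/forallP=> x; apply/forallP=> y; apply/forallP=> z.
by apply/implyP=> xy; apply/implyP; apply: rt xy.
Qed.

Record Quo (A : finType) := MkQuo {
  quo_graph :> {set A * A};
  quo_graphP : quasiorder quo_graph
}.

HB.instance Definition _ (A : finType) := [isSub for @quo_graph A].
HB.instance Definition _ (A : finType) := [Finite of Quo A by <:].

Section QuoLattice.
Context {A : finType}.
Implicit Types r s t : Quo A.

Lemma quo_refl r : reflexive (graph_rel r).
Proof. by case/quasiorderP: (quo_graphP r). Qed.

Lemma quo_trans r : transitive (graph_rel r).
Proof. by case/quasiorderP: (quo_graphP r). Qed.

Definition quo_le r s : bool := quo_graph r \subset quo_graph s.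

Fact quo_le_refl : reflexive quo_le.
Proof. by move=> r; apply: subxx. Qed.

Fact quo_le_anti : antisymmetric quo_le.
Proof.
by move=> r s rs; apply/val_inj/eqP; rewrite eqEsubset; apply: rs.
Qed.

Fact quo_le_trans : transitive quo_le.
Proof. by move=> s r t; apply: subset_trans. Qed.

Fact quo_meet_subproof r s : quasiorder (quo_graph r :&: quo_graph s).
Proof.
apply/quasiorderP; rewrite /graph_rel; split=> [x|y x z].
  by rewrite inE; apply/andP; split; apply: quo_refl.
rewrite !inE => /andP[rxy sxy] /andP[ryz syz].
by apply/andP; split; [apply: quo_trans rxy ryz | apply: quo_trans sxy syz].
Qed.

Definition quo_meet r s : Quo A := MkQuo (quo_meet_subproof r s).

(* [connect e] is the reflexive transitive closure of [e]; as r and s are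
   reflexive, here it is just the transitive closure of their union. *)
Definition quo_join_graph r s : {set A * A} :=
  [set p | connect (graph_rel (quo_graph r :|: quo_graph s)) p.1 p.2].

Fact quo_join_subproof r s : quasiorder (quo_join_graph r s).
Proof.
apply/quasiorderP; rewrite /graph_rel; split=> [x|y x z]; rewrite !inE //=.
exact: connect_trans.
Qed.

Definition quo_join r s : Quo A := MkQuo (quo_join_subproof r s).

Fact quo_meetP t r s : quo_le t (quo_meet r s) = quo_le t r && quo_le t s.
Proof. exact: subsetI. Qed.

Fact quo_joinP r s t : quo_le (quo_join r s) t = quo_le r t && quo_le s t.
Proof.
rewrite /quo_le -subUset; apply/subsetP/subsetP => [rst | rst] [x y].
  move=> xy; apply: rst; rewrite inE /=; exact: connect1.
rewrite inE /= => /connectP[p + ->].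
elim: p x => [|z p IHp] x /=; first by move=> _; apply: quo_refl.
by case/andP=> /rst xz /IHp; apply: (@quo_trans t z x).
Qed.

End QuoLattice.

Fact quo_display : Order.disp_t. Proof. exact: Order.Disp tt tt. Qed.

HB.instance Definition _ (A : finType) :=
  Order.Le_isPOrder.Build quo_display (Quo A)
    quo_le_refl quo_le_anti quo_le_trans.

HB.instance Definition _ (A : finType) :=
  Order.POrder_MeetJoin_isLattice.Build quo_display (Quo A)
    quo_meetP quo_joinP.

(* Main.v *)
Require Import Defs.
From mathcomp Require Import all_boot all_order.
From mathcomp Require Import zify.

Set Implicit Arguments.
Unset Strict Implicit.
Unset Printing Implicit Defensive.

Import Order.Theory.

(** Number the points 0, ..., n - 1 and view them as a path.  Three of the
    generators are equivalences: alpha has the two parity classes as blocks,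
    beta has the blocks {0,1}, {2,3}, ..., and gamma has the blocks {1,2},
    {3,4}, ..., with 0 alone.  The fourth generator delta consists of the
    single arrow 7 -> 1 and the single equivalence 2 ~ 6.  It lies below alpha,
    and this is the only comparability.  All of this works as soon as the
    points 0, ..., 8 exist.

    Any two of alpha, beta, gamma meet in the identity.  Hence if a quasiorder
    X lives on a few points only, then so does (X v beta) ^ alpha: the blocks
    of beta far from X are still blocks of the join, and they disappear in the
    meet.  The same holds for the other combinations, and
    they move X along the path: an arrow x -> y of X gives arrows between the
    neighbours of x and those of y.  Starting from delta, a short computation
    of this kind (lemmas descents and ascents) yields the atoms i -> i+1 and
    i+1 -> i for 2 <= i < 6, hence all atoms living on {2, ..., 6}.  Only
    finitely many points are involved, so each step is checked by evaluation
    on a window of the path.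

    From there the equivalences spread over the whole path.  Let u be the
    next point after an interval whose equivalence atoms are known, v its
    neighbour in the interval, and mu the one of beta, gamma that pairs u with
    v.  If {z, w} is another block of mu in the interval, then u ~ v can be
    obtained together with z ~ w: the equivalence with the block {u, v, z, w}
    is generated (lemma block_link).  Five points leave room for two disjoint
    choices of {z, w}, and the meet of the two equivalences is the atom u ~ v
    alone (lemma block_extend).

    Once all equivalence atoms are there, one arrow atom can be moved to any
    other position (lemma arrows_all), and every quasiorder is a join of arrow
    atoms (lemma realized_generates). *)

(** * Relations on the natural numbers *)

Definition parity : rel nat := fun x y => odd x == odd y.

(** The number of the block of x in beta (e = false) or in gamma (e = true). *)
Definition pairing (e : bool) (x : nat) : nat := (x + e)./2.

Definition matching (e : bool) : rel nat :=
  fun x y => pairing e x == pairing e y.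

Definition arrows (s : seq (nat * nat)) : rel nat :=
  fun x y => (x == y) || ((x, y) \in s).

Definition block (s : seq nat) : rel nat :=
  fun x y => (x == y) || ((x \in s) && (y \in s)).

Definition transb (s : seq (nat * nat)) : bool :=
  all (fun p => all (fun q => (p.2 == q.1) ==> arrows s p.1 q.2) s) s.

(** Paths of length two are shortcut; pairs (x, x) may appear, which is harmless
    because arrows is reflexive anyway. *)
Definition compose (s : seq (nat * nat)) : seq (nat * nat) :=
  undup (s ++ [seq (pq.1.1, pq.2.2) | pq <- [seq (p, q) | p <- s, q <- s]
                                    & pq.1.2 == pq.2.1]).

(** Three rounds shortcut all paths of length at most 8.  Nothing relies on this
    being the full transitive closure: transb is tested where it is needed. *)
Definition closure (s : seq (nat * nat)) : seq (nat * nat) := iter 3 compose s.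

Definition bounded (m : nat) (s : seq (nat * nat)) : bool :=
  all (fun p => (p.1 < m) && (p.2 < m)) s.

Definition agree (m : nat) (r1 r2 : rel nat) : bool :=
  all (fun x => all (fun y => r1 x y == r2 x y) (iota 0 m)) (iota 0 m).

Lemma arrows_refl s : reflexive (arrows s).
Proof. by move=> x; rewrite /arrows eqxx. Qed.

Lemma matching_refl e : reflexive (matching e).
Proof. by move=> x; apply: eqxx. Qed.

Lemma parity_refl : reflexive parity.
Proof. by move=> x; apply: eqxx. Qed.

Lemma arrows_trans s : transb s -> transitive (arrows s).
Proof.
move=> ts y x z /orP[/eqP-> //|xy] /orP[/eqP<-|yz].
  by rewrite /arrows xy orbT.
by have /allP/(_ _ yz)/implyP-> := allP ts _ xy.
Qed.

Lemma block_trans s : transitive (block s).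
Proof.
move=> y x z /orP[/eqP-> //|/andP[xs ys]] /orP[/eqP<-|/andP[_ zs]].
  by rewrite /block xs ys orbT.
by rewrite /block xs zs orbT.
Qed.

Lemma closure_incl s : {subset s <= closure s}.
Proof.
have step t : {subset t <= compose t}.
  by move=> p pt; rewrite mem_undup mem_cat pt.
by move=> p ps; do 3 apply: (step).
Qed.

Lemma closure_min (R : nat -> nat -> Prop) s :
    (forall y x z, R x y -> R y z -> R x z) ->
    (forall p, p \in s -> R p.1 p.2) ->
  forall p, p \in closure s -> R p.1 p.2.
Proof.
move=> Rt.
have step t : (forall p, p \in t -> R p.1 p.2) ->
              forall p, p \in compose t -> R p.1 p.2.
  move=> Rs p; rewrite mem_undup mem_cat => /orP[/Rs//|].
  case/mapP=> -[q1 q2]; rewrite mem_filter /= => /andP[/eqP q12].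
  case/allpairsP=> -[a b] [/= aq bq [q1a q2b]] -> /=; subst q1 q2.
  by apply: Rt (Rs _ aq) _; rewrite q12; apply: Rs.
by move=> Rs; do 3 apply: (step).
Qed.

Lemma agreeP m r1 r2 x y :
  agree m r1 r2 -> x < m -> y < m -> r1 x y = r2 x y.
Proof.
move=> /allP ag xm ym; have xi : x \in iota 0 m by rewrite mem_iota.
by have /allP/(_ y) := ag x xi; rewrite mem_iota => /(_ ym)/eqP.
Qed.

Lemma arrows_out m s x y :
  bounded m s -> ~~ ((x < m) && (y < m)) -> arrows s x y = (x == y).
Proof.
move=> /allP bs out; rewrite /arrows; case: eqP => //= _.
by apply/negP => /bs xym; rewrite xym in out.
Qed.

Lemma matching_parity e x y :
  pairing e x = pairing e y -> parity x y -> x = y.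
Proof. by rewrite /pairing /parity; lia. Qed.

Lemma matching_matching e x y :
  pairing e x = pairing e y -> matching (~~ e) x y -> x = y.
Proof. by rewrite /matching /pairing; case: e; lia. Qed.

Lemma pairing_fibre e a b x :
    pairing e a = pairing e b -> a != b ->
  (pairing e x == pairing e a) = (x == a) || (x == b).
Proof. by rewrite /pairing; case: e; lia. Qed.

(** In delta v beta there is one block {2,3,6,7} with arrows to {0,1}; the only
    block of gamma that meets both sets is {1,2}, so a single arrow 2 -> 1
    survives the meet with gamma.  Likewise 7 -> 6 is the meet of delta v gamma
    with beta, because reversing both the path 0, ..., 8 and all arrows
    preserves delta and exchanges beta with gamma. *)
Definition delta : seq (nat * nat) := [:: (7, 1); (2, 6); (6, 2)].

(** * Relations realized in a sublattice *)

Section Realized.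

Context {n : nat} (S : {set Quo 'I_n}).

(** Relations on the natural numbers stand for their restrictions to the points
    below n, which keeps ordinals out of all computations. *)
Definition realized (r : rel nat) : Prop :=
  exists2 q : Quo 'I_n,
    q \in S & forall x y : 'I_n, ((x, y) \in quo_graph q) = r x y.

Hypothesis latS : sublattice S.

Lemma realized_ext r1 r2 : r1 =2 r2 -> realized r1 -> realized r2.
Proof. by move=> r12 [q Sq qE]; exists q => // x y; rewrite qE r12. Qed.

Lemma realized_meet r1 r2 r :
    realized r1 -> realized r2 ->
    (forall x y, x < n -> y < n -> r x y = r1 x y && r2 x y) ->
  realized r.
Proof.
case=> q1 Sq1 q1E [q2 Sq2 q2E] rE.
exists (q1 `&` q2)%O; first exact: latS.1.
by move=> x y; rewrite inE q1E q2E rE.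
Qed.

(** The join is the least transitive relation above both arguments, so its value
    is certified by transitivity and by a minimality property, without looking
    at paths again. *)
Lemma realized_join r1 r2 (r : rel nat) :
    realized r1 -> realized r2 -> transitive r ->
    (forall x y, r1 x y -> r x y) -> (forall x y, r2 x y -> r x y) ->
    (forall R : rel 'I_n, transitive R ->
       (forall x y : 'I_n, r1 x y -> R x y) ->
       (forall x y : 'I_n, r2 x y -> R x y) ->
     forall x y : 'I_n, r x y -> R x y) ->
  realized r.
Proof.
case=> q1 Sq1 q1E [q2 Sq2 q2E] rt r1r r2r rmin.
exists (q1 `|` q2)%O; first exact: latS.2.
set e := graph_rel (quo_graph q1 :|: quo_graph q2).
have eE (x y : 'I_n) : e x y = r1 x y || r2 x y.
  by rewrite /e /graph_rel inE q1E q2E.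
move=> x y; rewrite inE /=; apply/idP/idP => [|xy].
  case/connectP=> p + ->; elim: p x => [|z p IHp] x /=.
    by move=> _; apply: r1r; rewrite -q1E; apply: quo_refl.
  rewrite -/e eE => /andP[xz /IHp]; apply: rt.
  by case/orP: xz => [/r1r|/r2r].
apply: rmin xy => [|{}x {}y xy|{}x {}y xy].
- by move=> v u w; apply: connect_trans.
- by apply: connect1; rewrite -/e eE xy.
- by apply: connect1; rewrite -/e eE xy orbT.
Qed.

(** Joining with a matching glues its blocks together, so the join is computed
    in the quotient: it is the preimage under pairing of the closure of the
    image of s. *)
Lemma realized_arrows_join_matching e m s
      (t := closure [seq (pairing e p.1, pairing e p.2) | p <- s]) :
    m <= n -> bounded m s -> transb t ->
    realized (arrows s) -> realized (matching e) ->
  realized (fun x y => arrows t (pairing e x) (pairing e y)).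
Proof.
move=> mn /allP bs tt Ss Se.
apply: realized_join Ss Se _ _ _ _.
- by move=> y x z; apply: arrows_trans.
- move=> x y /orP[/eqP->|xy]; first exact: arrows_refl.
  by apply/orP; right; apply: closure_incl; apply/mapP; exists (x, y).
- by move=> x y /eqP; rewrite /arrows => ->; rewrite eqxx.
move=> R Rt sR eR x y.
have fibre (u v : 'I_n) : pairing e u = pairing e v -> R u v.
  by move=> uv; apply: eR; rewrite /matching uv.
case/orP=> [/eqP/fibre //|xy].
(* Arrows between blocks, as induced by R on the points. *)
pose R' a b := exists u v : 'I_n, [/\ pairing e u = a, pairing e v = b & R u v].
have [||u [v [ux vy uv]]] := closure_min (R := R') _ _ xy.
- move=> b a c [u [v [ua vb uv]]] [v' [w [v'b wc v'w]]].
  exists u, w; split=> //; apply: (Rt _ _ _ uv); apply: Rt v'w.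
  by apply: fibre; rewrite vb.
- move=> _ /mapP[[a b] ab ->] /=; have /andP[/= am bm] := bs _ ab.
  exists (Ordinal (leq_trans am mn)), (Ordinal (leq_trans bm mn)).
  by split=> //; apply: sR; rewrite /arrows /= ab orbT.
by apply: (Rt _ _ _ (fibre _ _ (esym ux))); apply: Rt uv (fibre _ _ vy).
Qed.

Lemma realized_arrows_join m s1 s2 (t := closure (s1 ++ s2)) :
    m <= n -> bounded m (s1 ++ s2) -> transb t ->
    realized (arrows s1) -> realized (arrows s2) ->
  realized (arrows t).
Proof.
move=> mn /allP bs tt Ss1 Ss2.
apply: realized_join Ss1 Ss2 _ _ _ _.
- by move=> y x z; apply: arrows_trans.
- move=> x y /orP[/eqP->|xy]; first exact: arrows_refl.
  by apply/orP; right; apply: closure_incl; rewrite mem_cat xy.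
- move=> x y /orP[/eqP->|xy]; first exact: arrows_refl.
  by apply/orP; right; apply: closure_incl; rewrite mem_cat xy orbT.
move=> R Rt s1R s2R x y /orP[/eqP/val_inj<-|xy].
  by apply: s1R; apply: arrows_refl.
pose R' a b := exists u v : 'I_n, [/\ val u = a, val v = b & R u v].
have [||u [v [/val_inj-> /val_inj-> //]]] := closure_min (R := R') _ _ xy.
- move=> b a c [u [v [ua vb uv]]] [v' [w [v'b wc v'w]]].
  exists u, w; split=> //; apply: Rt uv _.
  by rewrite (val_inj (etrans vb (esym v'b))).
- move=> [a b] ab /=; have /andP[/= am bm] := bs _ ab.
  exists (Ordinal (leq_trans am mn)), (Ordinal (leq_trans bm mn)).
  split=> //; move: ab; rewrite mem_cat => /orP[ab|ab].
    by apply: s1R; rewrite /arrows /= ab orbT.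
  by apply: s2R; rewrite /arrows /= ab orbT.
Qed.

Lemma realized_arrows_meet m s r s' :
    reflexive r -> bounded m s -> bounded m s' ->
    agree m (fun x y => arrows s x y && r x y) (arrows s') ->
    realized (arrows s) -> realized r ->
  realized (arrows s').
Proof.
move=> rr bs bs' ag Ss Sr; apply: realized_meet Ss Sr _ => x y _ _.
have [/andP[xm ym]|out] := boolP ((x < m) && (y < m)).
  by rewrite -(agreeP ag).
by rewrite !(arrows_out _ out) //; case: eqP => //= ->; rewrite rr.
Qed.

(** The check that s' lists the arrows of (s v matching e) ^ r.  Points below 9
    lie in blocks numbered below 6, and the points of these blocks are below 12,
    so that a window of 12 points sees all arrows of t. *)
Definition zigzag_check e r s s' : bool :=
  let t := closure [seq (pairing e p.1, pairing e p.2) | p <- s] in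
  [&& bounded 9 s, transb t, bounded 6 t, bounded 12 s'
    & agree 12 (fun x y => arrows t (pairing e x) (pairing e y) && r x y)
        (arrows s')].

(** Outside the window the join with the matching has only the pairs of the
    matching, and these are removed by r. *)
Lemma realized_zigzag e (r : rel nat) s s' :
    9 <= n -> reflexive r ->
    (forall x y, pairing e x = pairing e y -> r x y -> x = y) ->
    zigzag_check e r s s' ->
    realized (matching e) -> realized r -> realized (arrows s) ->
  realized (arrows s').
Proof.
move=> n9 rr er /and5P[bs tt bt bs' ag] Se Sr Ss.
have St := realized_arrows_join_matching n9 bs tt Ss Se.
apply: realized_meet St Sr _ => x y _ _.
have [/andP[xm ym]|out] := boolP ((x < 12) && (y < 12)).
  by rewrite -(agreeP ag).
rewrite (arrows_out bs' out) (arrows_out bt).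
  have [<-|xy] := eqVneq x y; first by rewrite eqxx rr.
  by apply/esym/negP => /andP[/eqP/er exy /exy/eqP]; apply/negP.
by apply: contra out; rewrite /pairing; lia.
Qed.

Hypothesis Sa : realized parity.
Hypothesis Sm : forall e, realized (matching e).

(** * Atoms on the points 2, ..., 6 *)

Section Seed.

Hypothesis n9 : 9 <= n.
Hypothesis Sd : realized (arrows delta).

(* A step called mu_nu passes from X to (X v mu) ^ nu. *)

Let beta_alpha s s' : zigzag_check false parity s s' ->
  realized (arrows s) -> realized (arrows s').
Proof.
by move=> c; apply: (realized_zigzag n9 parity_refl (@matching_parity _) c).
Qed.

Let gamma_alpha s s' : zigzag_check true parity s s' ->
  realized (arrows s) -> realized (arrows s').
Proof.
by move=> c; apply: (realized_zigzag n9 parity_refl (@matching_parity _) c).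
Qed.

Let beta_gamma s s' : zigzag_check false (matching true) s s' ->
  realized (arrows s) -> realized (arrows s').
Proof.
move=> c.
exact: (realized_zigzag n9 (matching_refl _) (@matching_matching _) c).
Qed.

Let gamma_beta s s' : zigzag_check true (matching false) s s' ->
  realized (arrows s) -> realized (arrows s').
Proof.
move=> c.
exact: (realized_zigzag n9 (matching_refl _) (@matching_matching _) c).
Qed.

Let join s1 s2 (t := closure (s1 ++ s2)) :
  bounded 9 (s1 ++ s2) && transb t ->
  realized (arrows s1) -> realized (arrows s2) -> realized (arrows t).
Proof. by case/andP; apply: realized_arrows_join n9. Qed.

Let meet s1 s2 s' :
    [&& bounded 9 s1, bounded 9 s' &
      agree 9 (fun x y => arrows s1 x y && arrows s2 x y) (arrows s')] ->
  realized (arrows s1) -> realized (arrows s2) -> realized (arrows s').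
Proof.
case/and3P => b b' ag.
by apply: realized_arrows_meet b b' ag; apply: arrows_refl.
Qed.

Let meet_alpha s s' :
    [&& bounded 9 s, bounded 9 s' &
      agree 9 (fun x y => arrows s x y && parity x y) (arrows s')] ->
  realized (arrows s) -> realized (arrows s').
Proof.
case/and3P => b b' ag Ss.
exact: realized_arrows_meet parity_refl b b' ag Ss Sa.
Qed.

Let meet_matching e s s' :
    [&& bounded 9 s, bounded 9 s' &
      agree 9 (fun x y => arrows s x y && matching e x y) (arrows s')] ->
  realized (arrows s) -> realized (arrows s').
Proof.
case/and3P => b b' ag Ss.
exact: realized_arrows_meet (matching_refl e) b b' ag Ss (Sm e).
Qed.

(** The unwanted arrows of two such steps go different ways, so that a meet
    isolates a single arrow.  Up to the symmetry of delta, d76 mirrors d21, then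
    d65 mirrors d32 and d43 mirrors d54. *)
Lemma descents i : 2 <= i < 6 -> realized (arrows [:: (i.+1, i)]).
Proof.
have d21 : realized (arrows [:: (2, 1)]) by apply: beta_gamma Sd; vm_compute.
have d76 : realized (arrows [:: (7, 6)]) by apply: gamma_beta Sd; vm_compute.
have d32 : realized (arrows [:: (3, 2)]).
  have Q : realized (arrows [:: (2, 0); (2, 6); (6, 2); (6, 0);
                                (3, 1); (3, 7); (7, 3); (7, 1)]).
    by apply: beta_alpha Sd; vm_compute.
  have A1 : realized (arrows [:: (2, 0); (3, 1)]).
    by apply: beta_alpha d21; vm_compute.
  have A2 : realized (arrows [:: (1, 0); (3, 2)]).
    by apply: gamma_beta A1; vm_compute.
  by apply: meet (join _ Q d76) A2; vm_compute.
have d65 : realized (arrows [:: (6, 5)]).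
  have P : realized (arrows [:: (1, 5); (5, 1); (7, 1); (7, 5);
                                (2, 6); (6, 2); (8, 2); (8, 6)]).
    by apply: gamma_alpha Sd; vm_compute.
  have B1 : realized (arrows [:: (7, 5); (8, 6)]).
    by apply: gamma_alpha d76; vm_compute.
  have B2 : realized (arrows [:: (6, 5); (8, 7)]).
    by apply: beta_gamma B1; vm_compute.
  by apply: meet (join _ P d21) B2; vm_compute.
have L1 : realized (arrows [:: (3, 1); (4, 2)]).
  by apply: gamma_alpha d32; vm_compute.
have R1 : realized (arrows [:: (6, 4); (7, 5)]).
  by apply: beta_alpha d65; vm_compute.
have d54 : realized (arrows [:: (5, 4)]).
  have L2 : realized (arrows [:: (4, 2); (2, 0); (4, 0);
                                 (5, 3); (3, 1); (5, 1)]).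
    by apply: beta_alpha L1; vm_compute.
  have L3 : realized (arrows [:: (1, 0); (3, 2); (5, 4)]).
    by apply: gamma_beta L2; vm_compute.
  have R2 : realized (arrows [:: (5, 4); (7, 6)]).
    by apply: gamma_beta R1; vm_compute.
  by apply: meet L3 R2; vm_compute.
have d43 : realized (arrows [:: (4, 3)]).
  have R2 : realized (arrows [:: (7, 5); (5, 3); (7, 3);
                                 (8, 6); (6, 4); (8, 4)]).
    by apply: gamma_alpha R1; vm_compute.
  have R3 : realized (arrows [:: (4, 3); (6, 5); (8, 7)]).
    by apply: beta_gamma R2; vm_compute.
  have L2 : realized (arrows [:: (2, 1); (4, 3)]).
    by apply: beta_gamma L1; vm_compute.
  by apply: meet L2 R3; vm_compute.
by case: i => [|[|[|[|[|[|]]]]]].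
Qed.

(** With the atoms going down, 2 ~ 6 is a way back up: for instance the arrow
    3 -> 4 is the path 3 -> 2 -> 6 -> 4.  The other arrows created on the way
    join points that are not neighbours, or belong to the other matching, and
    the meet removes them. *)
Lemma ascents i : 2 <= i < 6 -> realized (arrows [:: (i, i.+1)]).
Proof.
have [[d32 d43] [d54 d65]] := ((descents (i := 2) isT, descents (i := 3) isT),
  (descents (i := 4) isT, descents (i := 5) isT)).
have d42 : realized (arrows [:: (4, 2)]).
  by apply: meet_alpha (join _ d43 d32); vm_compute.
have d64 : realized (arrows [:: (6, 4)]).
  by apply: meet_alpha (join _ d65 d54); vm_compute.
have u23 : realized (arrows [:: (2, 3)]).
  have J := join _ (join _ Sd d64) d43.
  by apply: (meet_matching (e := false)) (J _ _); vm_compute.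
have u34 : realized (arrows [:: (3, 4)]).
  have J := join _ (join _ Sd d32) d64.
  by apply: (meet_matching (e := true)) (J _ _); vm_compute.
have u45 : realized (arrows [:: (4, 5)]).
  have J := join _ (join _ Sd d42) d65.
  by apply: (meet_matching (e := false)) (J _ _); vm_compute.
have u56 : realized (arrows [:: (5, 6)]).
  have J := join _ (join _ Sd d54) d42.
  by apply: (meet_matching (e := true)) (J _ _); vm_compute.
by case: i => [|[|[|[|[|[|]]]]]].
Qed.

End Seed.

(** * Equivalences with one nontrivial block *)

Lemma realized_edge i j :
    realized (arrows [:: (i, j)]) -> realized (arrows [:: (j, i)]) ->
  realized (block [:: i; j]).
Proof.
have arrow_block a b c d : a \in [:: c; d] -> b \in [:: c; d] ->
    forall x y, arrows [:: (a, b)] x y -> block [:: c; d] x y.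
  move=> ac bc x y /orP[/eqP->|]; first by rewrite /block eqxx.
  by rewrite inE => /eqP[-> ->]; rewrite /block ac bc orbT.
move=> Sij Sji; apply: realized_join Sij Sji (@block_trans _) _ _ _.
- by apply: arrow_block; rewrite !inE eqxx ?orbT.
- by apply: arrow_block; rewrite !inE eqxx ?orbT.
move=> R Rt ijR jiR x y /orP[/eqP xy|].
  by apply: ijR; rewrite xy; apply: arrows_refl.
rewrite !inE => /andP[/orP[]/eqP-xE /orP[]/eqP-yE].
- by apply: ijR; rewrite xE yE; apply: arrows_refl.
- by apply: ijR; rewrite xE yE /arrows !inE eqxx orbT.
- by apply: jiR; rewrite xE yE /arrows !inE eqxx orbT.
- by apply: ijR; rewrite xE yE; apply: arrows_refl.
Qed.

Lemma block_join c s1 s2 :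
    c < n -> c \in s1 -> c \in s2 ->
    realized (block s1) -> realized (block s2) ->
  realized (block (s1 ++ s2)).
Proof.
move=> cn cs1 cs2 Ss1 Ss2; apply: realized_join Ss1 Ss2 (@block_trans _) _ _ _.
- move=> x y; rewrite /block !mem_cat => /orP[->//|/andP[-> ->]].
  by rewrite orbT.
- move=> x y; rewrite /block !mem_cat => /orP[->//|/andP[-> ->]].
  by rewrite !orbT.
move=> R Rt s1R s2R x y; rewrite /block => /orP[/eqP xy|].
  by apply: s1R; rewrite /block xy eqxx.
have viac (z : 'I_n) :
    val z \in s1 ++ s2 -> R z (Ordinal cn) && R (Ordinal cn) z.
  rewrite mem_cat => /orP[] zs.
    by rewrite !s1R // /block /= zs cs1 orbT.
  by rewrite !s2R // /block /= zs cs2 orbT.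
by case/andP=> /viac/andP[xc _] /viac/andP[_ cy]; apply: Rt xc cy.
Qed.

Lemma block_meet s1 s2 s :
    (forall x, (x \in s) = (x \in s1) && (x \in s2)) ->
    realized (block s1) -> realized (block s2) ->
  realized (block s).
Proof.
move=> sE Ss1 Ss2; apply: realized_meet Ss1 Ss2 _ => x y _ _.
by rewrite /block !sE andbACA orb_andr.
Qed.

Lemma block_eq_mem s1 s2 :
  s1 =i s2 -> realized (block s1) -> realized (block s2).
Proof. by move=> s12; apply: realized_ext => x y; rewrite /block !s12. Qed.

(** The four points are connected in the join of v ~ z with the matching.  The
    meet with parity removes the rest of the matching and leaves v ~ z and
    u ~ w; these two pairs are then connected by v ~ w. *)
Lemma block_link e u v z w :
    u < n -> v < n -> z < n -> w < n ->
    pairing e u = pairing e v -> pairing e w = pairing e z ->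
    u != v -> w != z -> odd z = odd v ->
    realized (block [:: v; z]) -> realized (block [:: v; w]) ->
  realized (block [:: u; v; z; w]).
Proof.
move=> un vn zn wn uv wz uNv wNz oddzv Svz Svw; set B := [:: u; v; z; w].
have oddwv : odd w == ~~ odd v by move: wz wNz oddzv; rewrite /pairing; lia.
(* The join of v ~ z with the matching. *)
pose big x y := matching e x y || (x \in B) && (y \in B).
have BE x :
    (x \in B) = (pairing e x == pairing e u) || (pairing e x == pairing e w).
  rewrite (pairing_fibre _ uv uNv) (pairing_fibre _ wz wNz) !inE.
  by rewrite [(x == w) || _]orbC !orbA.
have inB x y : matching e x y -> (x \in B) = (y \in B).
  by move=> /eqP xy; rewrite !BE xy.
have Sbig : realized big.
  apply: realized_join Svz (Sm e) _ _ _ _.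
  - move=> y x t /orP[xy|/andP[xB yB]] /orP[yt|/andP[yB' tB]].
    + by apply/orP; left; rewrite /matching (eqP xy).
    + by rewrite /big (inB _ _ xy) yB' tB orbT.
    + by rewrite /big -(inB _ _ yt) xB yB orbT.
    + by rewrite /big xB tB orbT.
  - move=> x y /orP[/eqP->|]; first by rewrite /big matching_refl.
    rewrite /big !inE => /andP[xvz yvz]; apply/orP; right.
    by case/orP: xvz => ->; case/orP: yvz => ->; rewrite ?orbT.
  - by move=> x y; rewrite /big => ->.
  move=> R Rt vzR eR x y /orP[/eR//|/andP[xB yB]].
  pose v' := Ordinal vn; pose z' := Ordinal zn.
  have [vz zv] : R v' z' /\ R z' v'.
    by split; apply: vzR; rewrite /block !inE !eqxx ?orbT.
  have nearv (t : 'I_n) : val t \in B -> R t v' && R v' t.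
    rewrite !inE => /or4P[]/eqP tE.
    - by rewrite !eR // /matching /= tE uv.
    - by rewrite !eR // /matching /= tE.
    - have [tz zt] : R t z' /\ R z' t.
        by split; apply: eR; rewrite /matching /= tE.
      by rewrite (Rt _ _ _ tz zv) (Rt _ _ _ vz zt).
    - have [tz zt] : R t z' /\ R z' t.
        by split; apply: eR; rewrite /matching /= tE wz.
      by rewrite (Rt _ _ _ tz zv) (Rt _ _ _ vz zt).
  by case/andP: (nearv _ xB) (nearv _ yB) => xv _ /andP[_ vy]; apply: Rt xv vy.
(* Its meet with parity. *)
pose small x y := (x == y) || [&& x \in B, y \in B & parity x y].
have Ssmall : realized small.
  apply: realized_meet Sbig Sa _ => x y _ _; rewrite /small /big /parity.
  have [->|xy] := eqVneq x y; first by rewrite matching_refl eqxx.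
  have [/= m|_] := boolP (matching e x y); last by rewrite andbA.
  by apply/idP/idP => [/and3P[] //|/(matching_parity (eqP m)) xy'];
    rewrite xy' eqxx in xy.
apply: realized_join Ssmall Svw (@block_trans _) _ _ _.
- move=> x y /orP[/eqP->|/and3P[xB yB _]]; rewrite /block ?eqxx //.
  by rewrite xB yB orbT.
- move=> x y /orP[/eqP->|]; first by rewrite /block eqxx.
  rewrite /block !inE => /andP[xvw yvw]; apply/orP; right.
  by case/orP: xvw => ->; case/orP: yvw => ->; rewrite ?orbT.
move=> R Rt sR vwR x y /orP[/eqP xy|/andP[xB yB]].
  by apply: sR; rewrite /small xy eqxx.
pose v' := Ordinal vn; pose w' := Ordinal wn.
have [vw wv] : R v' w' /\ R w' v'.
  by split; apply: vwR; rewrite /block !inE !eqxx ?orbT.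
have nearv (t : 'I_n) : val t \in B -> R t v' && R v' t.
  move=> tB; have inR (a b : 'I_n) : val a \in B -> val b \in B ->
      parity a b -> R a b && R b a.
    move=> aB bB ab; have ba : parity b a by rewrite /parity eq_sym.
    by apply/andP; split; apply: sR; rewrite /small aB bB ?ab ?ba orbT.
  have [tv|tw] : parity t v \/ parity t w.
    rewrite /parity (eqP oddwv).
    by case: (odd t); case: (odd v); [left | right | right | left].
  - by apply: (inR t v') => //; rewrite !inE eqxx ?orbT.
  - have /andP[tw' w't] : R t w' && R w' t.
      by apply: inR => //; rewrite !inE eqxx !orbT.
    by rewrite (Rt _ _ _ tw' wv) (Rt _ _ _ vw w't).
by case/andP: (nearv _ xB) (nearv _ yB) => xv _ /andP[_ vy]; apply: Rt xv vy.
Qed.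

(** The two blocks from block_link share u and v only. *)
Lemma block_extend e u v z1 w1 z2 w2 :
    all (fun x => x < n) [:: u; v; z1; w1; z2; w2] ->
    u != v -> w1 != z1 -> w2 != z2 -> ~~ has (mem [:: z1; w1]) [:: z2; w2] ->
    pairing e u = pairing e v ->
    pairing e w1 = pairing e z1 -> pairing e w2 = pairing e z2 ->
    odd z1 = odd v -> odd z2 = odd v ->
    (forall x, x \in [:: z1; w1; z2; w2] -> realized (block [:: v; x])) ->
  realized (block [:: u; v]).
Proof.
move=> /and5P[un vn z1n w1n /and3P[z2n w2n _]] uNv wNz1 wNz2 disj.
move=> uv wz1 wz2 oz1 oz2 near.
have S1 := block_link un vn z1n w1n uv wz1 uNv wNz1 oz1
  (near z1 _) (near w1 _).
have S2 := block_link un vn z2n w2n uv wz2 uNv wNz2 oz2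
  (near z2 _) (near w2 _).
apply: block_meet (S1 _ _) (S2 _ _); rewrite ?inE ?eqxx ?orbT // => x.
rewrite !inE !orbA; case: ((x == u) || (x == v)) => //=.
apply/esym/negP => /andP[x1 x2].
by case/hasP: disj; exists x; rewrite /= !inE.
Qed.

(** The block {i, j+2} is obtained along two paths, through j+1 and through j;
    the second one uses a step of length two, which is provided by parity. *)
Lemma block_interval lo hi :
    hi < n ->
    (forall i, lo <= i < hi -> realized (block [:: i; i.+1])) ->
  forall i j, lo <= i -> i < j <= hi -> realized (block [:: i; j]).
Proof.
move=> hn adj i j li.
have two k : lo <= k -> k.+1 < hi -> realized (block [:: k; k.+2]).
  move=> lk kh.
  have S3 : realized (block ([:: k; k.+1] ++ [:: k.+1; k.+2])).
    apply: (block_join (c := k.+1)); rewrite ?inE ?eqxx ?orbT //; first by lia.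
      by apply: adj; lia.
    by apply: adj; lia.
  apply: realized_meet S3 Sa _ => x y _ _.
  by rewrite /block /parity !inE; lia.
elim/ltn_ind: j => -[|[|j]] IHj ij; first by lia.
  by have i0 : i = 0; [lia | rewrite i0; apply: adj; lia].
have [->|ij1] := eqVneq i j.+1; first by apply: adj; lia.
have [->|ij0] := eqVneq i j; first by apply: two; lia.
have S1 : realized (block ([:: i; j.+1] ++ [:: j.+1; j.+2])).
  apply: (block_join (c := j.+1)); rewrite ?inE ?eqxx ?orbT //; first by lia.
    by apply: IHj; lia.
  by apply: adj; lia.
have S2 : realized (block ([:: i; j] ++ [:: j; j.+2])).
  apply: (block_join (c := j)); rewrite ?inE ?eqxx ?orbT //; first by lia.
    by apply: IHj; lia.
  by apply: two; lia.
by apply: block_meet S1 S2 => x; rewrite !inE; lia.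
Qed.

Lemma block_sym i j : realized (block [:: i; j]) -> realized (block [:: j; i]).
Proof. by apply: block_eq_mem => x; rewrite !inE orbC. Qed.

Lemma extend_right lo hi :
    lo + 4 <= hi -> hi.+1 < n ->
    (forall i, lo <= i < hi -> realized (block [:: i; i.+1])) ->
  realized (block [:: hi; hi.+1]).
Proof.
move=> lohi hn adj; have near := block_interval (ltnW hn) adj.
have [k hiE] : exists k, hi = k + 4 by exists (hi - 4); lia.
apply: block_sym.
(* The blocks {k, k+1} and {k+2, k+3} belong to the matching that pairs hi
   with hi+1. *)
apply: (@block_extend (odd hi) _ _ (k + 2) (k + 3) k (k + 1)).
- by rewrite /=; lia.
- by lia.
- by lia.
- by lia.
- by rewrite /= !inE; lia.
- by rewrite /pairing; lia.
- by rewrite /pairing; lia.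
- by rewrite /pairing; lia.
- by lia.
- by lia.
move=> x; rewrite !inE => xs; apply: block_sym; apply: near; lia.
Qed.

Lemma extend_left lo hi :
    0 < lo -> lo + 4 <= hi -> hi < n ->
    (forall i, lo <= i < hi -> realized (block [:: i; i.+1])) ->
  realized (block [:: lo.-1; lo]).
Proof.
move=> lo0 lohi hn adj; have near := block_interval hn adj.
apply: (@block_extend (odd lo.-1) _ _ (lo + 2) (lo + 1) (lo + 4) (lo + 3)).
- by rewrite /=; lia.
- by lia.
- by lia.
- by lia.
- by rewrite /= !inE; lia.
- by rewrite /pairing; lia.
- by rewrite /pairing; lia.
- by rewrite /pairing; lia.
- by lia.
- by lia.
move=> x; rewrite !inE => xs; apply: near; lia.
Qed.

Lemma extend_all lo hi :
    lo + 4 <= hi -> hi < n ->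
    (forall i, lo <= i < hi -> realized (block [:: i; i.+1])) ->
  forall i j, i < n -> j < n -> i != j -> realized (block [:: i; j]).
Proof.
move=> lohi hn adj.
have down k : k <= lo ->
    forall i, lo - k <= i < hi -> realized (block [:: i; i.+1]).
  elim: k => [|k IHk] klo i; first by rewrite subn0; apply: adj.
  have [->|ilo] := eqVneq i (lo - k.+1); last by move=> ih; apply: IHk; lia.
  move=> _; have := @extend_left (lo - k) hi _ _ hn (IHk (ltnW klo)).
  by rewrite -(subnSK klo) /=; apply; lia.
have up k : hi + k < n ->
    forall i, i < hi + k -> realized (block [:: i; i.+1]).
  elim: k => [|k IHk] kn i ik.
    by apply: (down lo); lia.
  have [->|ihi] := eqVneq i (hi + k); last by apply: IHk; lia.
  by apply: (@extend_right 0); [lia|lia|move=> t th; apply: IHk; lia].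
have adjn i : 0 <= i < n.-1 -> realized (block [:: i; i.+1]).
  by move=> ii; apply: (up (n.-1 - hi)); lia.
have n1 : n.-1 < n by lia.
move=> i j ii jn ij; have [ltij|] := ltnP i j.
  by apply: (block_interval n1 adjn); lia.
by move=> ji; apply: block_sym; apply: (block_interval n1 adjn); lia.
Qed.

(** * Arrows *)

(** If a -> b and b ~ c are joined, then a has arrows to b and c; the meet with
    a ~ c keeps the second one only. *)
Lemma arrow_head a b c :
    a < n -> b < n -> c < n -> a != b -> a != c ->
    realized (arrows [:: (a, b)]) ->
    realized (block [:: b; c]) -> realized (block [:: a; c]) ->
  realized (arrows [:: (a, c)]).
Proof.
move=> an bn cn ab ac Sab Sbc Sac.
pose r x y := block [:: b; c] x y || (x == a) && (y \in [:: b; c]).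
have Sr : realized r.
  apply: realized_join Sab Sbc _ _ _ _.
  - move=> y x z /orP[xy|/andP[xa ybc]] /orP[yz|/andP[ya zbc]].
    + by rewrite /r (block_trans xy yz).
    + move: xy; rewrite (eqP ya) /block !inE (negPf ab) (negPf ac) andbF orbF.
      by move=> /eqP->; rewrite /r eqxx zbc orbT.
    + rewrite /r xa; case/orP: yz => [/eqP<-|/andP[_ ->]].
        by rewrite ybc orbT.
      by rewrite orbT.
    + by rewrite /r xa zbc orbT.
  - move=> x y /orP[/eqP->|]; first by rewrite /r /block eqxx.
    by rewrite inE => /eqP[-> ->]; rewrite /r !inE !eqxx orbT.
  - by move=> x y; rewrite /r => ->.
  move=> R Rt abR bcR x y /orP[/bcR//|/andP[/eqP xa ybc]].
  have := abR x (Ordinal bn); rewrite /arrows inE xa eqxx orbT => /(_ isT) xb.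
  apply: Rt xb (bcR _ _ _).
  by rewrite /block ybc !inE eqxx orbT.
apply: realized_meet Sr Sac _ => x y _ _.
rewrite /r /block /arrows !inE xpair_eqE.
by case: eqVneq => //= xy; move: ab ac xy; lia.
Qed.

Lemma arrow_tail a b c :
    a < n -> b < n -> c < n -> a != b -> c != b ->
    realized (arrows [:: (a, b)]) ->
    realized (block [:: a; c]) -> realized (block [:: b; c]) ->
  realized (arrows [:: (c, b)]).
Proof.
move=> an bn cn ab cb Sab Sac Sbc.
pose r x y := block [:: a; c] x y || (x \in [:: a; c]) && (y == b).
have bac : b \in [:: a; c] = false.
  by rewrite !inE ![b == _]eq_sym (negPf ab) (negPf cb).
have Sr : realized r.
  apply: realized_join Sab Sac _ _ _ _.
  - move=> y x z /orP[xy|/andP[xac yb]] /orP[yz|/andP[yac zb]].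
    + by rewrite /r (block_trans xy yz).
    + rewrite /r zb; case/orP: xy => [/eqP->|/andP[-> _]].
        by rewrite yac orbT.
      by rewrite orbT.
    + move: yz; rewrite (eqP yb) /block bac /= orbF.
      by move=> /eqP<-; rewrite /r eqxx xac orbT.
    + by rewrite /r xac zb orbT.
  - move=> x y /orP[/eqP->|]; first by rewrite /r /block eqxx.
    by rewrite inE => /eqP[-> ->]; rewrite /r !inE !eqxx orbT.
  - by move=> x y; rewrite /r => ->.
  move=> R Rt abR acR x y /orP[/acR//|/andP[xac /eqP yb]].
  have := abR (Ordinal an) y; rewrite /arrows inE yb eqxx orbT => /(_ isT) ay.
  apply: Rt (acR _ _ _) ay.
  by rewrite /block xac !inE eqxx orbT.
apply: realized_meet Sr Sbc _ => x y _ _.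
rewrite /r /block /arrows !inE xpair_eqE.
by case: eqVneq => //= xy; move: ab cb xy; lia.
Qed.

(** Head and tail move freely to any third point, so a third point is used to
    reverse the arrow. *)
Lemma arrows_all a b :
    2 < n -> a < n -> b < n -> a != b ->
    (forall i j, i < n -> j < n -> i != j -> realized (block [:: i; j])) ->
    realized (arrows [:: (a, b)]) ->
  forall i j, i < n -> j < n -> i != j -> realized (arrows [:: (i, j)]).
Proof.
move=> n2 an bn ab Sblock Sab.
have head x y z : x < n -> y < n -> z < n -> x != y -> x != z ->
    realized (arrows [:: (x, y)]) -> realized (arrows [:: (x, z)]).
  move=> xn yn zn xy xz Sxy; have [<-//|yz] := eqVneq y z.
  by apply: (arrow_head xn yn zn) => //; apply: Sblock.
have tail x y z : x < n -> y < n -> z < n -> x != y -> z != y ->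
    realized (arrows [:: (x, y)]) -> realized (arrows [:: (z, y)]).
  move=> xn yn zn xy zy Sxy; have [<-//|xz] := eqVneq x z.
  by apply: (arrow_tail xn yn zn) => //; apply: Sblock => //; rewrite eq_sym.
have swap : realized (arrows [:: (b, a)]).
  have [c [cn ca cb]] : exists c, [/\ c < n, c != a & c != b].
    exists (if (0 != a) && (0 != b) then 0 else
            if (1 != a) && (1 != b) then 1 else 2).
    by case: ifP => h0; [|case: ifP => h1]; split; move: n2 h0 ab;
      try move: h1; lia.
  apply: (tail c a b) => //; first by rewrite eq_sym.
  by apply: (head c b a) => //; apply: (tail a b c).
move=> i j iN jN ij; have [ja|ja] := eqVneq j a; last first.
  apply: (tail a j i) => //; first by rewrite eq_sym.
  by apply: (head a b j) => //; rewrite eq_sym.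
by rewrite ja in ij *; apply: (tail b a i) => //; rewrite eq_sym.
Qed.

(** Every quasiorder is the join of its arrow atoms, collected one by one. *)
Lemma realized_generates :
    1 < n ->
    (forall i j, i < n -> j < n -> i != j -> realized (arrows [:: (i, j)])) ->
  S = [set: Quo 'I_n].
Proof.
move=> n1 Sarr; apply/setP => q; rewrite inE.
have n0 : 0 < n by apply: ltnW.
have [q0 Sq0 q0E] : realized (arrows [::]).
  apply: realized_meet (Sarr 0 1 n0 n1 isT) (Sarr 1 0 n1 n0 isT) _ => x y _ _.
  rewrite /arrows !inE; case: (x == y) => //=.
  by apply/esym/negP => /andP[/eqP[-> _] /eqP[]].
have cover (s : seq ('I_n * 'I_n)) : {subset s <= quo_graph q} ->
    exists2 q', q' \in S & {subset s <= quo_graph q'} /\ (q' <= q)%O.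
  elim: s => [|[x y] s IHs] sq.
    exists q0 => //; split=> //; apply/subsetP=> -[x y].
    by rewrite q0E /arrows orbF => /eqP/val_inj->; apply: quo_refl.
  have [|q' Sq' [sq' q'q]] := IHs.
    by move=> p ps; apply: sq; rewrite inE ps orbT.
  have [xy|xy] := eqVneq x y.
    exists q' => //; split=> // p; rewrite inE => /orP[/eqP->|/sq'//].
    by rewrite xy; apply: quo_refl.
  have [t St tE] := Sarr x y (ltn_ord x) (ltn_ord y) xy.
  exists (q' `|` t)%O; first exact: latS.2.
  have ql : quo_graph q' \subset quo_graph (q' `|` t)%O by apply: (leUl q' t).
  have tl : quo_graph t \subset quo_graph (q' `|` t)%O by apply: (leUr t q').
  split.
    move=> p; rewrite inE => /orP[/eqP->|/sq' pq']; last exact: (subsetP ql).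
    by apply: (subsetP tl); rewrite tE /arrows !inE eqxx orbT.
  rewrite leUx q'q /=; apply/subsetP=> -[u v].
  rewrite tE /arrows !inE => /orP[/eqP/val_inj->|/eqP[/val_inj-> /val_inj->]].
    exact: quo_refl.
  by apply: sq; rewrite inE eqxx.
have [p|q' Sq' [qq' q'q]] := cover (enum (quo_graph q)).
  by rewrite mem_enum.
suff -> : q = q' by [].
apply: le_anti; rewrite q'q andbT.
by apply/subsetP=> p pq; apply: qq'; rewrite mem_enum.
Qed.

Lemma delta_generates :
    9 <= n -> realized (arrows delta) -> S = [set: Quo 'I_n].
Proof.
move=> n9 Sd.
have adj i : 2 <= i < 6 -> realized (block [:: i; i.+1]).
  move=> i26.
  by apply: realized_edge; [apply: ascents | apply: descents].
have n6 : 6 < n by apply: ltn_trans n9.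
have Sblock := extend_all (lo := 2) (hi := 6) isT n6 adj.
apply: realized_generates => [|i j iN jN]; first exact: leq_trans n9.
apply: (arrows_all (a := 3) (b := 2)) => //; try exact: leq_trans n9.
by apply: (descents n9 Sd (i := 2)).
Qed.

End Realized.

(** * The four generators *)

Fact kernel_subproof n (T : eqType) (f : nat -> T) :
  quasiorder [set p : 'I_n * 'I_n | f p.1 == f p.2].
Proof.
apply/quasiorderP; rewrite /graph_rel.
by split=> [x|y x z]; rewrite !inE //= => /eqP->.
Qed.

Definition kernel n (T : eqType) (f : nat -> T) : Quo 'I_n :=
  MkQuo (kernel_subproof n f).

Fact delta_subproof n :
  quasiorder [set p : 'I_n * 'I_n | arrows delta p.1 p.2].
Proof.
apply/quasiorderP; rewrite /graph_rel.
split=> [x|y x z]; rewrite !inE /=; first exact: arrows_refl.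
exact: (@arrows_trans delta isT).
Qed.

Definition delta_quo n : Quo 'I_n := MkQuo (delta_subproof n).

Lemma quo_nle n (q1 q2 : Quo 'I_n) (x y : 'I_n) :
  (x, y) \in quo_graph q1 -> (x, y) \notin quo_graph q2 -> ~~ (q1 <= q2)%O.
Proof. by move=> xy1; apply: contra => /subsetP->. Qed.

Lemma is_112_subset4 d (L : finLatticeType d) (a b c e : L) :
    (e < a)%O -> (a >< b)%O -> (a >< c)%O -> (b >< c)%O -> (e >< b)%O ->
    (e >< c)%O ->
  is_112_subset [set a; b; c; e].
Proof.
move=> ea ab ac bc eb ec; have {ea} [ea eNa] : (e >=< a)%O /\ e != a.
  by rewrite lt_eqF // lt_comparable.
have incomp (x y : L) : (x >< y)%O -> x != y.
  by apply: contraNneq => ->; apply: comparablexx.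
split.
  have -> : [set a; b; c; e] = [set x in [:: a; b; c; e]].
    by apply/setP=> x; rewrite !inE -!orbA.
  rewrite cardsE; apply/card_uniqP.
  rewrite /= !inE !negb_or [a == e]eq_sym [b == e]eq_sym [c == e]eq_sym.
  by rewrite eNa !incomp.
suff -> : comparable_pairs [set a; b; c; e] = [set [set e; a]].
  by rewrite cards1.
apply/setP=> P; rewrite inE.
apply/idP/eqP => [/imset2P[x y xX yX ->]|->]; last first.
  by apply: imset2_f; rewrite !inE ?eqxx ?orbT ?eNa.
have sym (s t : L) : (s >< t)%O -> (t >=< s)%O = false.
  by rewrite comparable_sym => /negPf.
move: xX yX; rewrite !inE -!orbA => xX /andP[yX /andP[xNy xy]]; move: yX xNy xy.
by case/or4P: xX => /eqP-> /or4P[]/eqP->;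
  rewrite ?eqxx ?(negPf ab) ?(negPf ac) ?(negPf bc) ?(negPf eb) ?(negPf ec)
          ?(sym _ _ ab) ?(sym _ _ ac) ?(sym _ _ bc) ?(sym _ _ eb) ?(sym _ _ ec)
          // setUC.
Qed.

Lemma is_112_generated_Quo n : 9 <= n -> is_112_generated (Quo 'I_n).
Proof.
move=> n9; pose pt k (k9 : k < 9) : 'I_n := Ordinal (leq_trans k9 n9).
pose q0 := kernel n odd; pose q1 := kernel n (pairing false).
pose q2 := kernel n (pairing true); pose q3 := delta_quo n.
have nle k l (k9 : k < 9) (l9 : l < 9) q q' :
    (pt k k9, pt l l9) \in quo_graph q ->
    (pt k k9, pt l l9) \notin quo_graph q' ->
    (q <= q')%O = false.
  by move=> klq klq'; apply/negbTE; apply: quo_nle klq klq'.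
exists [set q0; q1; q2; q3]; split.
  apply: is_112_subset4.
  - rewrite lt_neqAle; apply/andP; split.
      apply/eqP=> q30.
      have : (pt 0 isT, pt 2 isT) \in quo_graph q0 by rewrite inE.
      by rewrite -q30 inE.
    apply/subsetP=> -[x y]; rewrite !inE /arrows => /orP[/eqP->//|].
    by rewrite !inE => /or3P[]/eqP[-> ->].
  - by rewrite negb_or (nle 0 2) ?(nle 0 1) ?inE.
  - by rewrite negb_or (nle 0 2) ?(nle 1 2) ?inE.
  - by rewrite negb_or (nle 0 1) ?(nle 1 2) ?inE.
  - by rewrite negb_or (nle 2 6) ?(nle 0 1) ?inE.
  - by rewrite negb_or (nle 2 6) ?(nle 1 2) ?inE.
move=> S latS /subsetP sub.
have Sa : realized S parity.
  exists q0 => [|x y]; last by rewrite inE.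
  by apply: sub; rewrite !inE eqxx.
have Sm e : realized S (matching e).
  exists (if e then q2 else q1).
    by apply: sub; case: e; rewrite !inE eqxx ?orbT.
  by move=> x y; case: e; rewrite inE.
apply: delta_generates => //.
exists q3; first by apply: sub; rewrite !inE eqxx ?orbT.
by move=> x y; rewrite inE.
Qed.

Theorem theorem3p3 (n : nat) (n_gt0 : 0 < n) :
  (11 <= n -> odd n -> is_112_generated (Quo 'I_n)) /\
  (13 <= n -> is_112_generated (Quo 'I_n)).
Proof.
by split=> [n11 _|n13]; apply: is_112_generated_Quo; lia.
Qed.
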